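(* Let $K/k$ be a small extension of algebraically closed analytic fields. Then any chain $\{F_i\}_{i\in I}$ (with respect to inclusion) of intermediate algebraically closed analytic fields $k\subseteq F_i\subseteq K$ is of at most countable cofinality.
   Context: An analytic field is a field complete with respect to a real-valued (rank at most one, possibly trivial) multiplicative non-archimedean absolute value $|\ |$. An extension of analytic fields is a field extension in which the absolute value of the larger field restricts to that of the smaller one; an intermediate analytic field is an intermediate field that is complete with respect to the induced absolute value. For a valued field $K$, $K^a$ denotes an algebraic closure with the extended absolute value, and $\widehat{\ \cdot\ }$ denotes completion. For an extension $K/k$ of analytic fields and a subset $S\subset K$, $\widehat{k(S)^a}$ denotes the closure in $\widehat{K^a}$ of the algebraic closure of $k(S)$. A set $S\subset K$ is t.a. (topologically-algebraically) generating for $K/k$ if $\widehat{K^a}=\widehat{k(S)^a}$. The topological generating degree $\mathrm{Tr.c}(K/k)$ is the minimum of the cardinalities of t.a. generating sets. The extension $K/k$ is called small if $\mathrm{Tr.c}(K/k)$ is finite. *)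

(* Defs.v *)
(* MathComp-Analysis. *)
From HB Require Import structures.
From mathcomp Require Import all_boot all_order all_algebra.
From mathcomp Require Import all_classical all_reals.

Set Implicit Arguments.
Unset Strict Implicit.
Unset Printing Implicit Defensive.

Import Order.TTheory GRing.Theory Num.Theory.

Local Open Scope classical_set_scope.
Local Open Scope card_scope.
Local Open Scope ring_scope.

(* The metric notions are spelled out for an R-valued function v on K, the
   hierarchy having no common extension of fields and of R-normed groups for
   an R other than the field itself. *)
Section Metric.
Variables (R : realType) (K : zmodType) (v : K -> R).

Definition cauchy_seq_for (u : nat -> K) : Prop :=
  forall e : R, 0 < e -> exists N : nat,
    forall m n : nat, (N <= m)%N -> (N <= n)%N -> v (u m - u n) < e.

Definition cvg_seq_for (u : nat -> K) (x : K) : Prop :=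
  forall e : R, 0 < e -> exists N : nat,
    forall n : nat, (N <= n)%N -> v (u n - x) < e.

Definition complete_for (F : set K) : Prop :=
  forall u : nat -> K, (forall n, F (u n)) -> cauchy_seq_for u ->
    exists2 x : K, F x & cvg_seq_for u x.

Definition closure_for (A : set K) : set K :=
  [set x | forall e : R, 0 < e -> exists2 y : K, A y & v (x - y) < e].

End Metric.

(* The trivial absolute value is allowed. *)
HB.mixin Record Field_isAnalytic (R : realType) K of GRing.Field K := {
  absv : K -> R;
  absv_ge0 : forall x : K, 0 <= absv x;
  absv_eq0 : forall x : K, absv x = 0 <-> x = 0;
  absvM : forall x y : K, absv (x * y) = absv x * absv y;
  absv_ultra : forall x y : K, absv (x + y) <= Num.max (absv x) (absv y);
  absv_complete : complete_for absv setT
}.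

#[short(type="analyticFieldType")]
HB.structure Definition AnalyticField (R : realType) :=
  {K of GRing.Field K & Field_isAnalytic R K}.

Section Subfields.
Variable K : fieldType.
Implicit Types E F S : set K.

Definition subfield F : Prop := divring_closed (mem F).

Definition algclosed_in F : Prop :=
  forall p : {poly K}, (forall i, F p`_i) -> (1 < size p)%N ->
    exists2 x, F x & root p x.

(* The relative algebraic closure of E in K. *)
Definition algelts E : set K :=
  [set x | exists p : {poly K}, [/\ p != 0, forall i, E p`_i & root p x]].

End Subfields.

Section Extensions.
Variable R : realType.

Definition isometric (k K : analyticFieldType R) (f : k -> K) : Prop :=
  forall x : k, absv (f x) = absv x.

Definition complete_in (K : analyticFieldType R) (F : set K) : Prop :=
  complete_for absv F.

Definition closure_in (K : analyticFieldType R) (A : set K) : set K :=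
  closure_for absv A.

Definition intermediate_analytic (k K : analyticFieldType R)
    (f : {rmorphism k -> K}) (F : set K) : Prop :=
  [/\ subfield F, range f `<=` F & complete_in F].

(* j presents C as the completion of an algebraic closure K^a of K: the
   elements of C algebraic over K form an algebraically closed dense subset. *)
Definition completed_algclosure (K C : analyticFieldType R)
    (j : {rmorphism K -> C}) : Prop :=
  [/\ isometric j, algclosed_in (algelts (range j))
    & closure_in (algelts (range j)) = setT].

Section Generation.
Variables (k K C : analyticFieldType R).
Variables (f : {rmorphism k -> K}) (j : {rmorphism K -> C}).

(* k(S) *)
Definition adjoin (S : set K) : set K :=
  smallest (@subfield K) (range f `|` S).

Definition ta_generating (S : set K) : Prop :=
  closure_in (algelts (j @` adjoin S)) = setT.

(* The cardinality of S is Tr.c(K/k). *)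
Definition realizes_Trc (S : set K) : Prop :=
  ta_generating S /\ forall T : set K, ta_generating T -> S #<= T.

End Generation.

(* Tr.c(K/k) is finite; it does not depend on the choice of (C, j), completed
   algebraic closures of K being unique up to isometric K-isomorphism. *)
Definition small (k K : analyticFieldType R) (f : {rmorphism k -> K}) : Prop :=
  exists (C : analyticFieldType R) (j : {rmorphism K -> C}),
    completed_algclosure j /\
    exists2 S : set K, realizes_Trc f j S & finite_set S.

End Extensions.

Definition chain (T I : Type) (F : I -> set T) : Prop :=
  forall i i' : I, F i `<=` F i' \/ F i' `<=` F i.

(* Some at most countable subfamily is cofinal. *)
Definition countable_cofinality (T I : Type) (F : I -> set T) : Prop :=
  exists J : set I, countable J /\ forall i, exists2 i', J i' & F i `<=` F i'.

(* Main.v *)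
(* Suppose that no countable subfamily of the chain is cofinal, so that every
   sequence of F_i's is bounded in the chain; let x_1, ..., x_n be t.a.
   generators.  The generators are dropped one at a time, the invariant being
   that for some i every algebraic closure (in K) of F_j(x_1, ..., x_m) lies in
   the topological closure of that of F_i(x_1, ..., x_m).  Boundedness of
   sequences yields an i such that L = F_i(x_1, ..., x_(m-1))^a approximates
   x = x_m as well as every larger member of the chain does.  Such a larger F
   lies in the closure of L(x)^a, but x is orthogonal to F over L, so F already
   lies in the closure of L.  With no generator left, completeness of F_i gives
   F_j <= F_i for all j. *)
Require Import Defs.
From HB Require Import structures.
From mathcomp Require Import all_boot all_order all_algebra ring.
From mathcomp Require Import all_classical all_reals.

Set Implicit Arguments.
Unset Strict Implicit.
Unset Printing Implicit Defensive.

Import Order.TTheory GRing.Theory Num.Theory.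

Local Open Scope classical_set_scope.
Local Open Scope ring_scope.

(** * Subfields as field types, relative algebraic closure and splitting of polynomials *)

Section SubfieldType.
Variables (K : fieldType) (L : set K) (subL : subfield L).

(* The unused argument h lets instance inference recover the closure proof. *)
Definition subfield_pred (h : subfield L) : {pred K} := mem L.
Local Notation P := (subfield_pred subL).

HB.instance Definition _ := GRing.isDivringClosed.Build K P subL.

Record subfield_type := SubfieldElt {
  subfield_val :> K; _ : subfield_val \in P }.

HB.instance Definition _ := [isSub for subfield_val].
HB.instance Definition _ := [Choice of subfield_type by <:].
HB.instance Definition _ :=
  [SubChoice_isSubIntegralDomain of subfield_type by <:].
HB.instance Definition _ :=
  [SubIntegralDomain_isSubField of subfield_type by <:].

Lemma subfield_poly_lift (p : {poly K}) : (forall i, L p`_i) ->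
  exists q : {poly subfield_type}, p = map_poly val q.
Proof.
move=> Lp; have Lp' i : p`_i \in P by apply/mem_set.
exists (\poly_(i < size p) (SubfieldElt (Lp' i))).
apply/polyP => i; rewrite coef_map coef_poly.
by case: ltnP => // /(nth_default 0).
Qed.

Lemma algelts_algebraicOver x :
  algelts L x <-> algebraicOver (val : subfield_type -> K) x.
Proof.
split=> [[p [pn0 /subfield_poly_lift[q pq] px]]|[p pn0 px]].
  by exists q; rewrite -?pq//; rewrite pq map_poly_eq0 in pn0.
exists (map_poly val p); split=> //; first by rewrite map_poly_eq0.
by move=> i; rewrite coef_map /=; apply/set_mem/(valP p`_i).
Qed.

Lemma subfield_algelts : subfield (algelts L).
Proof.
split=> [|x y|x y]; rewrite ?inE.
- by apply/algelts_algebraicOver/algebraic1.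
- move=> /algelts_algebraicOver ? /algelts_algebraicOver ?.
  by apply/algelts_algebraicOver/algebraic_sub.
- move=> /algelts_algebraicOver ? /algelts_algebraicOver ?.
  by apply/algelts_algebraicOver/algebraic_div.
Qed.

Lemma sub_algelts : L `<=` algelts L.
Proof.
move=> x Lx; apply/algelts_algebraicOver.
exact: (algebraic_id _ (SubfieldElt (mem_set Lx : x \in P))).
Qed.

(** A root in [K] of a polynomial with coefficients algebraic over [L] is integral over those
    coefficients, hence algebraic over [L]. *)
Lemma algclosed_in_algelts :
  algclosed_in [set: K] -> algclosed_in (algelts L).
Proof.
move=> Kcl p Lp sp; have [//|x _ px] := Kcl p _ sp; exists x => //.
have pn0 : p != 0 by rewrite -size_poly_gt0 (ltn_trans _ sp).
apply/algelts_algebraicOver/integral_algebraic.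
apply: (integral_root pn0 px) => c /(nthP 0)[i _ <-].
exact/integral_algebraic/algelts_algebraicOver.
Qed.

Lemma algclosed_in_split (p : {poly K}) : algclosed_in L ->
    (forall i, L p`_i) ->
  exists2 s : seq K, {in s, forall c, L c} &
    p = lead_coef p *: \prod_(c <- s) ('X - c%:P).
Proof.
move=> Lcl /subfield_poly_lift[q ->].
suff [s qE] : exists s : seq subfield_type,
    q = lead_coef q *: \prod_(c <- s) ('X - c%:P).
  exists (map val s); first by move=> _ /mapP[c _ ->]; exact/set_mem/(valP c).
  rewrite {1}qE map_polyZ lead_coef_map rmorph_prod big_map; congr (_ *: _).
  by apply: eq_bigr => c _; exact: map_polyXsubC.
have [n] := ubnP (size q); elim: n q => // n IH q.
have [sq1 _|sq1] := leqP (size q) 1.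
  exists [::]; rewrite big_nil alg_polyC.
  by rewrite {1}[q]size1_polyC// [q]size1_polyC// lead_coefC coefC.
rewrite ltnS => sqn.
have Lq i : L (map_poly val q)`_i.
  by rewrite coef_map; exact/set_mem/(valP q`_i).
have [|x Lx] := Lcl _ Lq; first by rewrite size_map_poly.
have -> : x = val (SubfieldElt (mem_set Lx : x \in P)) by [].
move: (SubfieldElt _) => {Lx}x; rewrite fmorph_root => /factor_theorem[r qE].
have rn0 : r != 0 by apply: contraTneq sq1 => r0; rewrite qE r0 mul0r size_poly0.
have [|s rE] := IH r.
  by apply: leq_trans sqn; rewrite qE size_Mmonic ?monicXsubC// size_XsubC addn2.
exists (x :: s); rewrite big_cons qE lead_coefM lead_coefXsubC mulr1.
by rewrite mulrC {1}rE scalerAr.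
Qed.

Lemma algclosed_in_id : algclosed_in L -> algelts L = L.
Proof.
move=> Lcl; apply/seteqP; split=> [x [p [pn0 Lp]]|]; last exact: sub_algelts.
have [s Ls ->] := algclosed_in_split Lcl Lp.
by rewrite rootZ ?lead_coef_eq0// root_prod_XsubC => /Ls.
Qed.

Lemma polyOver_subfieldP (p : {poly K}) :
  p \is a polyOver P <-> forall i, L p`_i.
Proof.
split=> [/polyOverP Pp i|Lp]; first exact/set_mem/Pp.
by apply/polyOverP => i; apply/mem_set.
Qed.

End SubfieldType.

Lemma subfield_setT (K : fieldType) : subfield [set: K].
Proof. by split=> [|x y|x y]; rewrite !inE. Qed.

Lemma algclosed_in_setT (K : fieldType) :
  GRing.closed_field_axiom K -> algclosed_in [set: K].
Proof.
move=> Kcl p _ sp.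
have pn0 : lead_coef p != 0 by rewrite lead_coef_eq0 -size_poly_gt0 ltnW.
(* The axiom solves an equation expressing [x ^+ n] through lower powers of [x], so [p] is made
   monic and its lower coefficients change sign. *)
have [|x xE] := Kcl (size p).-1 (fun i => - (lead_coef p)^-1 * p`_i).
  by rewrite -subn1 subn_gt0.
exists x => //; rewrite /root horner_coef -[size p]prednK ?(ltnW sp)//.
rewrite big_ord_recr /= -/(lead_coef p) xE mulr_sumr -big_split big1// => i _ /=.
by rewrite mulNr mulNr mulrN !mulrA mulfV// mul1r subrr.
Qed.

Lemma subfield_smallest (K : fieldType) (A : set K) :
  subfield (smallest (@subfield K) A).
Proof.
split=> [|x y|x y]; rewrite ?inE.
- by move=> E [[E1 _ _] _]; apply/set_mem.
- move=> Ax Ay E EA; have [[_ EB _] _] := EA.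
  by apply/set_mem/EB; apply/mem_set; [apply: Ax|apply: Ay].
- move=> Ax Ay E EA; have [[_ _ EV] _] := EA.
  by apply/set_mem/EV; apply/mem_set; [apply: Ax|apply: Ay].
Qed.

(** * Fractions in one adjoined element *)

Section Adjoin.
Variables (K : fieldType) (L : set K) (subL : subfield L) (x : K).
Local Notation P := (subfield_pred subL).

Lemma adjoin_sub_fractions : smallest (@subfield K) (L `|` [set x]) `<=`
  [set u | exists p q : {poly K}, [/\ p \is a polyOver P, q \is a polyOver P,
                                     q.[x] != 0 & u = p.[x] / q.[x]]].
Proof.
apply: smallest_sub; last first.
  move=> u [Lu|->].
    exists u%:P, 1; rewrite polyOverC rpred1 !hornerE oner_neq0 divr1; split=> //.
    exact: mem_set.
  by exists 'X, 1; rewrite polyOverX rpred1 !hornerE oner_neq0 divr1.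
split=> [|u v|u v]; rewrite ?inE.
- by exists 1, 1; rewrite rpred1 !hornerE oner_neq0 invr1.
- move=> [p [q [Pp Pq qx ->]]] [p' [q' [Pp' Pq' qx' ->]]].
  exists (p * q' - p' * q), (q * q').
  by rewrite rpredB ?rpredM// !hornerE mulf_neq0//; split=> //; field; apply/andP.
- move=> [p [q [Pp Pq qx ->]]] [p' [q' [Pp' Pq' qx' ->]]].
  (* A zero divisor gives the quotient 0 by the convention [0^-1 = 0]; it is written [0 / 1]. *)
  have [p'x|p'x] := eqVneq p'.[x] 0.
    exists 0, 1; rewrite rpred0 rpred1 !hornerE oner_neq0 p'x.
    by rewrite !mul0r invr0 mulr0.
  exists (p * q'), (q * p').
  by rewrite !rpredM// !hornerE mulf_neq0//; split=> //; field; apply/and3P.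
Qed.

(** Clears denominators in an equation [p(W) = 0] over [L(x)]: [Q] is a polynomial [P(W, V)] over
    [L], with outer variable [W], such that [P(W, x) = d(x) p(W)]. *)
Lemma common_denominator (p : {poly K}) :
    (forall i, smallest (@subfield K) (L `|` [set x]) p`_i) ->
  exists (d : {poly K}) (Q : {poly {poly K}}),
    [/\ d \is a polyOver P, Q \is a polyOver (polyOver_pred P), d.[x] != 0
      & map_poly (horner_eval x) Q = d.[x] *: p].
Proof.
elim/poly_ind: p => [|p c IH] Hp.
  by exists 1, 0; rewrite hornerC oner_neq0 !rpred0 rpred1 map_poly0 scaler0.
have [|d [Q [Pd PQ dn0 QE]]] := IH.
  by move=> i; move: (Hp i.+1); rewrite coefD coefMX coefC addr0.
have := Hp 0%N; rewrite coefD coefMX coefC add0r.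
move=> /adjoin_sub_fractions[a [b [Pa Pb bx ->]]].
exists (d * b), (Q * 'X * b%:P + (d * a)%:P); split.
- by rewrite rpredM.
- by rewrite rpredD ?rpredM ?polyOverX ?polyOverC// rpredM.
- by rewrite hornerM mulf_neq0.
rewrite rmorphD !rmorphM /= !map_polyC map_polyX QE /= /horner_eval !hornerM.
rewrite scalerDr -!mul_polyC -!polyCM -mulrA.
rewrite [_ * (_ / _)](_ : _ = d.[x] * a.[x]); last by field.
by rewrite polyCM -!mulrA; congr (_ + _); ring.
Qed.

End Adjoin.

(** * Non-archimedean estimates, closures and approximation *)

Section Absolute.
Variables (R : realType) (K : analyticFieldType R).
Implicit Types (x y z : K) (L : set K).

Lemma absv0 : absv (0 : K) = 0.
Proof. exact/absv_eq0. Qed.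

Lemma absv1 : absv (1 : K) = 1.
Proof.
have n0 : absv (1 : K) != 0 by apply/eqP => /absv_eq0/eqP; rewrite oner_eq0.
by apply: (mulfI n0); rewrite -absvM !mulr1.
Qed.

Lemma absvN x : absv (- x) = absv x.
Proof.
have : absv (-1 : K) ^+ 2 = 1 by rewrite expr2 -absvM mulrNN mulr1 absv1.
move=> /eqP; rewrite sqrf_eq1 => /orP[/eqP e1|/eqP e1].
  by rewrite -mulN1r absvM e1 mul1r.
by have := absv_ge0 (-1 : K); rewrite e1 oppr_ge0 ler10.
Qed.

Lemma absvX x n : absv (x ^+ n) = absv x ^+ n.
Proof.
by elim: n => [|n IH]; rewrite ?expr0 ?absv1// !exprS absvM IH.
Qed.

Lemma absvB_le x y e : absv x <= e -> absv y <= e -> absv (x - y) <= e.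
Proof.
by move=> xe ye; apply: le_trans (absv_ultra _ _) _; rewrite ge_max xe absvN.
Qed.

Lemma absvB_lt x y e : absv x < e -> absv y < e -> absv (x - y) < e.
Proof.
by move=> xe ye; apply: le_lt_trans (absv_ultra _ _) _; rewrite gt_max xe absvN.
Qed.

Lemma absvD_lt x y e : absv x < e -> absv y < e -> absv (x + y) < e.
Proof. by move=> xe ye; rewrite -[y]opprK absvB_lt ?absvN. Qed.

Lemma absv_distC x y : absv (x - y) = absv (y - x).
Proof. by rewrite -absvN opprB. Qed.

Lemma absv_gt0 x : (0 < absv x) = (x != 0).
Proof.
rewrite lt0r absv_ge0 andbT; congr (~~ _).
by apply/eqP/eqP => /absv_eq0.
Qed.

Lemma absv_sum_lt (n : nat) (u : nat -> K) (e : R) : 0 < e ->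
  (forall i, absv (u i) < e) -> absv (\sum_(i < n) u i) < e.
Proof.
move=> e0 ue; elim: n => [|n IH]; first by rewrite big_ord0 absv0.
by rewrite big_ord_recr/= absvD_lt.
Qed.

Lemma sub_closure_in (A : set K) : A `<=` closure_in A.
Proof. by move=> x Ax e e0; exists x => //; rewrite subrr absv0. Qed.

Lemma closure_inS (A B : set K) : A `<=` B -> closure_in A `<=` closure_in B.
Proof. by move=> AB x Ax e /Ax[y /AB]; exists y. Qed.

Lemma closure_in_complete (A : set K) : complete_in A -> closure_in A = A.
Proof.
move=> cA; apply/seteqP; split; last exact: sub_closure_in.
move=> x Ax; have Hx (n : nat) : exists y, A y /\ absv (x - y) < n.+1%:R^-1.
  by have [|y] := Ax n.+1%:R^-1; [rewrite invr_gt0|exists y].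
have {Hx}[u uP] := choice Hx.
have ux e : 0 < e -> exists N, forall n, (N <= n)%N -> absv (u n - x) < e.
  move=> e0; exists (Num.truncn e^-1) => n Nn; rewrite absv_distC.
  apply: lt_trans (uP n).2 _; rewrite invf_plt ?posrE//.
  by rewrite (lt_le_trans (truncnS_gt _))// ler_nat.
have [|e e0|y Ay uy] := cA u; first by move=> n; exact: (uP n).1.
  have [N NP] := ux e e0; exists N => m n Nm Nn.
  have := absvB_lt (NP _ Nm) (NP _ Nn).
  by rewrite opprB addrA subrK.
suff -> : x = y by [].
apply/eqP; rewrite -subr_eq0 -[_ == _]negbK -absv_gt0; apply/negP => xy0.
have [N NP] := ux _ xy0; have [M MP] := uy _ xy0.
have := absvB_lt (MP _ (leq_maxl M N)) (NP _ (leq_maxr M N)).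
by rewrite opprB addrC addrA subrK ltxx.
Qed.

(** [q] splits over [L], and passing from [y] to [z] changes each linear factor by less than its
    value at [y]; the strict inequality survives products. *)
Lemma absv_horner_near L y z (q : {poly K}) : subfield L -> algclosed_in L ->
    (forall c, L c -> absv (y - z) < absv (y - c)) ->
    (forall i, L q`_i) -> q != 0 ->
  absv (q.[y] - q.[z]) < absv q.[y].
Proof.
move=> subL Lcl yz Lq q0; have [s Ls ->] := algclosed_in_split subL Lcl Lq.
rewrite !hornerZ -mulrBr !absvM ltr_pM2l ?absv_gt0 ?lead_coef_eq0//.
elim: s Ls => [|c s IH] Ls.
  by rewrite big_nil !hornerC subrr absv0 absv1.
have {}IH : absv ((\prod_(c <- s) ('X - c%:P)).[y] -
    (\prod_(c <- s) ('X - c%:P)).[z]) < absv (\prod_(c <- s) ('X - c%:P)).[y].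
  by apply: IH => d ds; apply: Ls; rewrite inE ds orbT.
rewrite big_cons !hornerM !hornerXsubC.
set u := (_.[y]) in IH *; set v := (_.[z]) in IH *.
have yc : absv (y - z) < absv (y - c) by apply/yz/Ls; rewrite inE eqxx.
have vu : absv v <= absv u by rewrite -[v](subKr u) absvB_le// ltW.
have u0 : 0 < absv u by apply: le_lt_trans IH; exact: absv_ge0.
rewrite (_ : _ - _ = (y - c) * (u - v) + (y - z) * v); last by ring.
apply: absvD_lt; rewrite !absvM.
  by rewrite ltr_pM2l// (le_lt_trans _ yc)// absv_ge0.
by apply: le_lt_trans (ler_wpM2l (absv_ge0 _) vu) _; rewrite ltr_pM2r.
Qed.

(* The Gauss norm of radius |x| is multiplicative, and on the linear factors
   allowed here it is bounded by the value at x. *)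
Lemma gauss_norm_le x (s : seq K) (a : K) :
    {in s, forall b, absv x <= absv (x - b) /\ absv b <= absv (x - b)} ->
  forall i, absv (a *: \prod_(b <- s) ('X - b%:P))`_i * absv x ^+ i <=
            absv (a *: \prod_(b <- s) ('X - b%:P)).[x].
Proof.
move=> sx i; rewrite coefZ hornerZ !absvM -mulrA ler_wpM2l ?absv_ge0//.
elim: s sx i => [|b s IH] sx i.
  rewrite big_nil hornerC coefC absv1.
  by case: i => [|i]; rewrite ?absv0 ?mul0r ?absv1 ?mulr1.
have {}IH j := IH (fun c (cs : c \in s) => sx c (@mem_behead _ (b :: s) c cs)) j.
have [xb bb] : absv x <= absv (x - b) /\ absv b <= absv (x - b).
  by apply: sx; rewrite inE eqxx.
(* The coefficient of degree [i] of [(X - b) Q] is [Q_(i-1) - b Q_i]; the first term is bounded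
   through [xb], the second through [bb], and for [i = 0] the first is 0. *)
rewrite big_cons hornerM hornerXsubC absvM mulrBl coefB coefXM coefCM.
rewrite -absvX -absvM mulrBl; apply: absvB_le; rewrite absvM.
  case: i => [|i] /=; first by rewrite absv0 mul0r mulr_ge0 ?absv_ge0.
  by rewrite absvX exprS mulrCA ler_pM// ?mulr_ge0 ?exprn_ge0 ?absv_ge0.
by rewrite absvX absvM -mulrA ler_pM// ?mulr_ge0 ?exprn_ge0 ?absv_ge0.
Qed.

(* If y in F keeps a positive distance from L, choose z algebraic over L(x)
   closer to y than L is, and P over L with P(z, x) = 0.  Expand P(w, V) in
   powers of V - a, with a in L at least as close to x as the roots in F of
   P(y, V): each term at (y, x) is bounded by P(y, x), and replacing y by z
   changes it by strictly less, so P(z, x) cannot vanish. *)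
Lemma best_approx_closure (L F : set K) x :
    subfield L -> algclosed_in L -> subfield F -> algclosed_in F -> L `<=` F ->
    (forall b, F b -> exists2 a, L a & absv (x - a) <= absv (x - b)) ->
    F `<=` closure_in (algelts (smallest (@subfield K) (L `|` [set x]))) ->
  F `<=` closure_in L.
Proof.
move=> subL Lcl subF Fcl LF approx Fx y Fy; apply: contrapT.
move=> /existsNP[e /not_implyP[e0 yL]].
have [z [p [p0 Ep pz]] yz] := Fx y Fy e e0.
(* [z] is within [e] of [y], and no element of [L] is. *)
have {}yL c : L c -> absv (y - z) < absv (y - c).
  move=> Lc; apply: lt_le_trans yz _; rewrite leNgt; apply/negP => yc.
  by apply: yL; exists c.
have [d [P [_ PL dn0 PE]]] := common_denominator subL Ep.
(* S w is the polynomial P(w, V) in the variable V. *)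
pose S w := P.[w%:P].
have SF : forall i, F (S y)`_i.
  apply/(polyOver_subfieldP subF); apply: rpred_horner.
    apply: polyOverS PL => r /(polyOver_subfieldP subL) Lr.
    by apply/(polyOver_subfieldP subF) => i; apply: LF.
  by rewrite [_ \in _]polyOverC; apply: mem_set.
have [s Fs SE] := algclosed_in_split subF Fcl SF.
(* There are finitely many roots: of two approximants the one nearer to [x] is kept. Without roots
   any element of [L] will do, such as 0. *)
have [a La aP] : exists2 a, L a & {in s, forall b, absv (x - a) <= absv (x - b)}.
  elim: s Fs {SE} => [_|b s IH Fs].
    by exists 0 => //; exact/set_mem/(rpred0 (subfield_pred subL)).
  have [c cs|a La aP] := IH; first by apply: Fs; rewrite inE cs orbT.
  have [|a' La' a'P] := approx b; first by apply: Fs; rewrite inE eqxx.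
  have [aa'|/ltW aa'] := leP (absv (x - a)) (absv (x - a')).
    exists a => // c; rewrite inE => /orP[/eqP ->|/aP//].
    exact: le_trans aa' a'P.
  exists a' => // c; rewrite inE => /orP[/eqP ->//|/aP].
  exact: le_trans aa'.
(* Taylor expansion at [a]: [q i], a polynomial in [W] over [L], is the coefficient of [(V - a)^i]
   in [P(W, V)]. *)
pose T w := S w \Po ('X + a%:P).
pose q i := map_poly (fun r => (r \Po ('X + a%:P))`_i) P.
have TE w i : (T w)`_i = (q i).[w].
  rewrite /T /S /q horner_coef linear_sum coef_sum horner_poly.
  apply: eq_bigr => j _ /=.
  by rewrite -polyC_exp mulrC mul_polyC comp_polyZ coefZ mulrC.
have qE i j : (q i)`_j = (P`_j \Po ('X + a%:P))`_i.
  by rewrite coef_map_id0// comp_poly0 coef0.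
have Lq i j : L (q i)`_j.
  rewrite qE; apply: (polyOver_subfieldP subL _).1; apply: polyOver_comp.
    by move/polyOverP: PL; apply.
  by rewrite rpredD ?polyOverX// polyOverC; apply: mem_set.
have absq i : q i != 0 -> absv ((q i).[y] - (q i).[z]) < absv (q i).[y].
  exact: absv_horner_near (Lq i).
(* A nonzero [q i] does not vanish at [y], by [absq]. If all these terms were 0, then
   [P(W, x) = d(x) p(W)] would be 0 as well. *)
have [i0 qi0] : exists i, (q i).[y] * (x - a) ^+ i != 0.
  apply: contrapT => /forallNP q0.
  have /eqP : map_poly (horner_eval x) P = 0.
    apply/polyP => j; rewrite coef_map coef0 /= /horner_eval.
    have -> : (P`_j).[x] = (P`_j \Po ('X + a%:P)).[x - a].
      by rewrite horner_comp !hornerE subrK.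
    rewrite horner_coef big1// => i _; rewrite -qE.
    have /negP := q0 i; rewrite negbK mulf_eq0 => /orP[|/eqP ->]; last first.
      by rewrite mulr0.
    have [->|/absq] := eqVneq (q i) 0; first by rewrite coef0 mul0r.
    by move=> + /eqP qy; rewrite qy absv0 ltNge absv_ge0.
  by rewrite PE scaler_eq0 (negPf dn0) (negPf p0).
have Tz : (T z).[x - a] = 0.
  rewrite horner_comp !hornerE subrK.
  have := horner_map (horner_eval x) P z%:P.
  rewrite PE /= /horner_eval hornerC => <-.
  by rewrite hornerZ (rootP pz) mulr0.
have gauss i : absv (T y)`_i * absv (x - a) ^+ i <= absv (T y).[x - a].
  have -> : T y = lead_coef (S y) *: \prod_(b <- map (+%R^~ (- a)) s) ('X - b%:P).
    rewrite /T {1}SE comp_polyZ rmorph_prod big_map; congr (_ *: _).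
    apply: eq_bigr => b _ /=; rewrite comp_polyB comp_polyX comp_polyC polyCB.
    by rewrite opprB addrA addrAC.
  apply: gauss_norm_le => _ /mapP[b bs ->].
  rewrite (_ : x - a - (b - a) = x - b); last by ring.
  split; first exact: aP.
  rewrite (_ : b - a = (x - a) - (x - b)); last by ring.
  by apply: absvB_le => //; exact: aP.
pose m := absv (T y).[x - a].
have m0 : 0 < m.
  apply: lt_le_trans (gauss i0).
  by rewrite TE -absvX -absvM absv_gt0.
(* As [T z] vanishes at [x - a], [m] is also the value of [T y - T z] there, and each term of that
   sum is smaller than [m]. *)
suff : m < m by rewrite ltxx.
rewrite {1}/m -[(T y).[_]]subr0 -Tz -hornerN -hornerD horner_coef.
apply: (absv_sum_lt _ (u := fun i => (T y - T z)`_i * (x - a) ^+ i)) => // i.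
rewrite coefB !TE; have [->|/absq qi] := eqVneq (q i) 0.
  by rewrite !horner0 subrr mul0r absv0.
have [->|xi] := eqVneq ((x - a) ^+ i) 0; first by rewrite mulr0 absv0.
apply: lt_le_trans (gauss i); rewrite absvM absvX TE ltr_pM2r//.
by rewrite -absvX absv_gt0.
Qed.

End Absolute.

(** Density descends from [C] to [K]: an element [c] algebraic over [j(k(S))] is a root of the image
    of a polynomial over [k(S)], which splits in [K]. So [c = j b] with [b] algebraic over [k(S)],
    and [b] is as close to [x] as [c] to [j x]. *)
Lemma ta_generating_closure (R : realType) (k K C : analyticFieldType R)
    (f : {rmorphism k -> K}) (j : {rmorphism K -> C}) (S : set K) :
    algclosed_in [set: K] -> isometric j -> ta_generating f j S ->
  closure_in (algelts (adjoin f S)) = setT.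
Proof.
move=> Kcl jiso jS; apply/seteqP; split=> // x _ e e0.
have : closure_in (algelts (j @` adjoin f S)) (j x) by rewrite jS.
move=> /(_ e e0)[c [p [p0 Sp pc]] xc].
have /choice[u uP] i : exists y, adjoin f S y /\ j y = p`_i.
  by have [y Sy jy] := Sp i; exists y.
pose q := \poly_(i < size p) u i.
have qE : map_poly j q = p.
  apply/polyP => i; rewrite coef_map coef_poly.
  case: ltnP => [_|/(nth_default 0)->]; [exact: (uP i).2|exact: rmorph0].
have Sq i : adjoin f S q`_i.
  rewrite coef_poly; case: ltnP => _; first exact: (uP i).1.
  exact/set_mem/(rpred0 (subfield_pred (subfield_smallest _))).
have q0 : q != 0 by rewrite -(map_poly_eq0 j) qE.
have [s _ sE] := algclosed_in_split (@subfield_setT K) Kcl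
  (fun i => I : setT q`_i).
move: pc; rewrite -qE sE map_polyZ rootZ ?fmorph_eq0 ?lead_coef_eq0//.
rewrite rmorph_prod (eq_bigr (fun b => 'X - (j b)%:P)); last first.
  by move=> b _; exact: map_polyXsubC.
rewrite -(big_map j xpredT (fun b => 'X - b%:P)) root_prod_XsubC.
move=> /mapP[b bs cb]; exists b; last by rewrite -jiso rmorphB -cb.
exists q; split=> //; rewrite sE rootZ ?lead_coef_eq0//.
by rewrite root_prod_XsubC.
Qed.

(** * Chains in which every sequence is bounded *)

Section Chains.
Variables (R : realType) (K : analyticFieldType R).
Implicit Types (A : set K).

Definition alghull A : set K := algelts (smallest (@subfield K) A).

Lemma subfield_alghull A : subfield (alghull A).
Proof. exact/subfield_algelts/subfield_smallest. Qed.

Lemma algclosed_in_alghull A : algclosed_in [set: K] -> algclosed_in (alghull A).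
Proof. exact/algclosed_in_algelts/subfield_smallest. Qed.

Lemma algeltsS A A' : A `<=` A' -> algelts A `<=` algelts A'.
Proof. by move=> AA' x [p [p0 Ap px]]; exists p; split=> // i; apply: AA'. Qed.

Lemma alghullS A A' : A `<=` A' -> alghull A `<=` alghull A'.
Proof.
move=> AA'; apply: algeltsS; apply: sub_smallest2r => //.
exact: subfield_smallest.
Qed.

Lemma sub_alghull A : A `<=` alghull A.
Proof.
move=> x Ax; apply: (sub_algelts (subfield_smallest A)).
exact: sub_gen_smallest.
Qed.

Variables (I : Type) (F : I -> set K).
Hypothesis F_chain : chain F.
Hypothesis F_bounded : forall u : nat -> I, exists i, forall n, F (u n) `<=` F i.
Hypothesis K_closed : algclosed_in [set: K].

(** If the distance from [x] to the union of the [L i] is attained, an index where this happens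
    works. Otherwise indices coming within [1/(n+1)] of it form a sequence, and a bound of that
    sequence works. *)
Lemma exists_best_approx (L : I -> set K) (i0 : I) (x : K) :
    (forall i i', F i `<=` F i' -> L i `<=` L i') -> (forall i, L i 0) ->
  exists i, forall i' b, L i' b ->
    exists2 a, L i a & absv (x - a) <= absv (x - b).
Proof.
move=> FL L0.
pose D : set R := [set absv (x - b) | b in \bigcup_i L i].
have Dlb : has_lbound D by exists 0 => _ [b _ <-]; exact: absv_ge0.
have [[b [i _ Lb] bE]|Dinf] := pselect (D (inf D)).
  exists i => i' b' Lb'; exists b; rewrite // bE.
  by apply: ge_inf => //; exists b' => //; exists i'.
have D0 : has_inf D by split=> //; exists (absv (x - 0)), 0 => //; exists i0.
have Du (n : nat) : exists i, exists2 b, L i b &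
    absv (x - b) < inf D + n.+1%:R^-1.
  have n0 : 0 < n.+1%:R^-1 :> R by rewrite invr_gt0.
  have [_ [b [i _ Lb] <-] bD] := inf_adherent n0 D0.
  by exists i, b.
have [u uP] := choice Du; have [i ui] := F_bounded u.
exists i => i' b Lb.
have : inf D < absv (x - b).
  by apply: (inf_lb_strict Dlb Dinf); exists b => //; exists i'.
rewrite -subr_gt0 => bD.
set n := Num.truncn (absv (x - b) - inf D)^-1.
have [a La aD] := uP n; exists a; first exact: FL (ui n) _ La.
apply/ltW/(lt_le_trans aD); rewrite -lerBrDl.
by rewrite invf_ple ?posrE// ltW// truncnS_gt.
Qed.

Lemma alghull_cons A (s : seq K) (x : K) :
  alghull (A `|` [set` x :: s]) `<=`
  alghull (alghull (A `|` [set` s]) `|` [set x]).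
Proof.
apply: alghullS => y [Ay|]; first by left; apply: sub_alghull; left.
rewrite /= inE => /orP[/eqP->|ys]; first by right.
by left; apply: sub_alghull; right.
Qed.

Lemma chain_drop_generators (s : seq K) :
    (exists i, forall i', alghull (F i' `|` [set` s]) `<=`
                          closure_in (alghull (F i `|` [set` s]))) ->
  exists i, forall i', F i' `<=` closure_in (alghull (F i)).
Proof.
elim: s => [|x s IH] [i0 Hi0].
  exists i0 => i'; have := Hi0 i'; rewrite set_nil !setU0.
  by move=> hullF y /sub_alghull/hullF.
apply: IH; pose L i := alghull (F i `|` [set` s]).
have FL i i' : F i `<=` F i' -> L i `<=` L i'.
  by move=> ii'; apply: alghullS; exact: setSU.
have [|i1 Hi1] := exists_best_approx i0 x FL.
  by move=> i; exact/set_mem/(rpred0 (subfield_pred (subfield_alghull _))).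
(* Both properties persist above [i0] and [i1]: closures of larger hulls are larger, and the
   approximants found in [L i1] lie in [L i]. *)
have [i [Fi0 Fi1]] : exists i, F i0 `<=` F i /\ F i1 `<=` F i.
  by have [] := F_chain i0 i1; [exists i1|exists i0]; split=> // ?.
exists i => i'; have [/FL LL|Fi] := F_chain i' i.
  exact: subset_trans LL (@sub_closure_in _ _ _).
apply: (@best_approx_closure _ _ _ _ x); try exact: subfield_alghull;
  try exact: algclosed_in_alghull.
- exact: FL.
- by move=> b /Hi1[a La xa]; exists a => //; exact: FL Fi1 _ La.
- apply: subset_trans _ (closure_inS (@alghull_cons (F i) s x)).
  apply: subset_trans _ (closure_inS (alghullS (setSU Fi0))).
  apply: subset_trans _ (Hi0 i'); apply: alghullS; apply: setUS => y /= ys.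
  by rewrite inE ys orbT.
Qed.

End Chains.

Theorem theorem2p2p6 (R : realType) (k K : analyticFieldType R)
    (f : {rmorphism k -> K}) (f_isometric : isometric f)
    (k_closed : GRing.closed_field_axiom k)
    (K_closed : GRing.closed_field_axiom K)
    (K_small : small f)
    (I : Type) (F : I -> set K)
    (F_intermediate : forall i, intermediate_analytic f (F i))
    (F_closed : forall i, algclosed_in (F i))
    (F_chain : chain F) :
  countable_cofinality F.
Proof.
have Kcl := algclosed_in_setT K_closed.
have [i0|I0] := pselect (inhabited I); last first.
  exists set0; split; first exact: countable0.
  by move=> i; case: I0; exists.
case: i0 => i0; apply: contrapT => notcof.
(* An unbounded sequence has cofinal range: in a chain, an [F (u n)] not inside [F i] contains
   [F i]. *)
have F_bounded (u : nat -> I) : exists i, forall n, F (u n) `<=` F i.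
  apply: contrapT => /forallNP unb; apply: notcof; exists (range u).
  split; first exact: card_le_trans (card_image_le _ _) (countableP _).
  move=> i; have /existsNP[n un] := unb i.
  by exists (u n); [exists n|case: (F_chain i (u n))].
have [C [j [[jiso _ _] [S [Sgen _] /finite_seqP[s Ss]]]]] := K_small.
have [|i Hi] := chain_drop_generators F_chain F_bounded Kcl (s := s).
  (* Any index starts the descent: [F i0] contains the image of [k], so with the generators its hull
     is already dense in [K]. *)
  exists i0 => i' x _; have := ta_generating_closure Kcl jiso Sgen.
  rewrite -Ss => /seteqP[_ /(_ x Logic.I)]; apply: closure_inS.
  by apply: alghullS; apply: setSU; have [] := F_intermediate i0.
(* [F i] is a complete, algebraically closed subfield, so hull and closure add nothing to it and [i]
   alone is cofinal. *)
apply: notcof; exists [set i]; split=> // i'; exists i => //.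
have [subF _ Fcomplete] := F_intermediate i.
apply: subset_trans (Hi i') _; rewrite /alghull smallest_id//.
by rewrite algclosed_in_id// closure_in_complete.
Qed.
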